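(* Let $(\Omega,\mathcal A)$ be a Borel space, $(\Omega,X_\bullet)$ a Borel field of proper CAT(0) spaces and $x^0_\bullet\in\mathcal L(\Omega,X_\bullet)$. For each $\omega$ let $i_\omega:X_\omega\to\mathcal C_0(X_\omega)$, $i_\omega(x)=d_\omega(x,\cdot)-d_\omega(x,x^0_\omega)$. Then: (i) for every $x_\bullet\in\mathcal L(\Omega,X_\bullet)$ the section $\omega\mapsto i_\omega(x_\omega)$ belongs to the Borel structure of $\mathcal C_0(X_\bullet)$ (so $i_\bullet$ is a continuous morphism), and the subfields $\omega\mapsto i_\omega(X_\omega)$ and $\omega\mapsto\overline{i_\omega(X_\omega)}$ are Borel subfields of $\mathcal C_0(X_\bullet)$; (ii) the subfield $\omega\mapsto\partial X_\omega:=\overline{i_\omega(X_\omega)}\setminus i_\omega(X_\omega)$ is a Borel subfield of closed subsets of $\overline{i_\bullet(X_\bullet)}$.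
   Context: Borel field of metric spaces: $(X_\omega,d_\omega)_{\omega\in\Omega}$ metric spaces; a section is $x_\bullet=(x_\omega)$, $x_\omega\in X_\omega$. A Borel structure is a set $\mathcal L(\Omega,X_\bullet)$ of sections such that (a) $\omega\mapsto d_\omega(x_\omega,y_\omega)$ is Borel for all $x_\bullet,y_\bullet\in\mathcal L$; (b) any section $y_\bullet$ with $\omega\mapsto d_\omega(x_\omega,y_\omega)$ Borel for all $x_\bullet\in\mathcal L$ lies in $\mathcal L$; (c) there is a countable $\mathcal D=\{x^n_\bullet\}\subseteq\mathcal L$ with $\{x^n_\omega\}_n$ dense in $X_\omega$ for all $\omega$. For Borel $\Omega'$, $\mathcal L(\Omega',X_\bullet)$ = restrictions to $\Omega'$ of Borel sections. A subfield is $A_\bullet=(A_\omega)$ with $A_\omega\subseteq X_\omega$ (possibly empty); it is Borel if $\Omega'=\{\omega:A_\omega\ne\emptyset\}\in\mathcal A$ and there are countably many $y^n_\bullet\in\mathcal L(\Omega',X_\bullet)$ with $y^n_\omega\in A_\omega$ and $A_\omega\subseteq\overline{\{y^n_\omega\}_n}$ for all $\omega\in\Omega'$. $\mathcal C(X_\omega)$ carries the metric $\delta_\omega(f,g)=\inf\{\varepsilon>0\mid\sup_{x\in B(x^0_\omega,1/\varepsilon)}|f(x)-g(x)|<\varepsilon\}$ (uniform convergence on compacta) and the Borel structure $\mathcal L(\Omega,\mathcal C(X_\bullet))=\{f_\bullet\mid\omega\mapsto f_\omega(x_\omega)\text{ Borel for all Borel }x_\bullet\}$; $\mathcal C_0(X_\omega)=\{f\in\mathcal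 C(X_\omega): f(x^0_\omega)=0\}$ is a Borel subfield of it, with the induced Borel structure. The set $\overline{i_\omega(X_\omega)}\setminus i_\omega(X_\omega)$ consists of the Busemann functions $b_{x^0_\omega,\xi}$, $\xi$ in the visual boundary, and is thereby identified with $\partial X_\omega$ with its cone topology. *)

(* Defs.v *)
From Stdlib Require Import Reals Lra List ClassicalEpsilon.
Open Scope R_scope.

Definition sigma_algebra {Om : Type} (A : (Om -> Prop) -> Prop) : Prop :=
  A (fun _ => True) /\
  (forall S, A S -> A (fun w => ~ S w)) /\
  (forall S : nat -> Om -> Prop, (forall n, A (S n)) -> A (fun w => exists n, S n w)).

Definition open_R (U : R -> Prop) : Prop :=
  forall x, U x -> exists e, e > 0 /\ forall y, Rabs (y - x) < e -> U y.

Definition borel_R (S : R -> Prop) : Prop :=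
  forall Sig : (R -> Prop) -> Prop, sigma_algebra Sig ->
    (forall U, open_R U -> Sig U) -> Sig S.

Definition borel_fun {Om : Type} (A : (Om -> Prop) -> Prop) (f : Om -> R) : Prop :=
  forall S, borel_R S -> A (fun w => S (f w)).

Definition is_metric {T : Type} (d : T -> T -> R) : Prop :=
  (forall x y, 0 <= d x y) /\ (forall x y, d x y = 0 <-> x = y) /\
  (forall x y, d x y = d y x) /\ (forall x y z, d x z <= d x y + d y z).

Definition open_set {T : Type} (d : T -> T -> R) (U : T -> Prop) : Prop :=
  forall x, U x -> exists e, e > 0 /\ forall y, d x y < e -> U y.

Definition compact {T : Type} (d : T -> T -> R) (K : T -> Prop) : Prop :=
  forall (I : Type) (U : I -> T -> Prop), (forall i, open_set d (U i)) ->
    (forall x, K x -> exists i, U i x) ->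
    exists l : list I, forall x, K x -> exists i, In i l /\ U i x.

Definition proper_space {T : Type} (d : T -> T -> R) : Prop :=
  forall x r, compact d (fun y => d x y <= r).

Definition geodesic_path {T : Type} (d : T -> T -> R) (x y : T) (g : R -> T) : Prop :=
  g 0 = x /\ g 1 = y /\
  forall s t, 0 <= s <= 1 -> 0 <= t <= 1 -> d (g s) (g t) = Rabs (s - t) * d x y.

(* CAT(0): geodesic, and every geodesic triangle satisfies the comparison
   inequality.  For sides [x,y] (length a) and [x,z] (length b) and third
   side length c, the Euclidean comparison points at distances s*a and t*b
   from the comparison vertex of x are at squared distance
   s^2 a^2 + t^2 b^2 - s t (a^2 + b^2 - c^2) (law of cosines). *)
Definition CAT0 {T : Type} (d : T -> T -> R) : Prop :=
  (forall x y, exists g, geodesic_path d x y g) /\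
  forall x y z g h s t, geodesic_path d x y g -> geodesic_path d x z h ->
    0 <= s <= 1 -> 0 <= t <= 1 ->
    (d (g s) (h t)) ^ 2 <=
      s ^ 2 * (d x y) ^ 2 + t ^ 2 * (d x z) ^ 2
      - s * t * ((d x y) ^ 2 + (d x z) ^ 2 - (d y z) ^ 2).

Definition borel_field {Om : Type} (A : (Om -> Prop) -> Prop) (X : Om -> Type)
  (d : forall w, X w -> X w -> R) (L : (forall w, X w) -> Prop) : Prop :=
  (forall w, is_metric (d w)) /\
  (forall x y, L x -> L y -> borel_fun A (fun w => d w (x w) (y w))) /\
  (forall y : forall w, X w,
     (forall x, L x -> borel_fun A (fun w => d w (x w) (y w))) -> L y) /\
  (exists D : nat -> forall w, X w, (forall n, L (D n)) /\
     forall w (z : X w) e, e > 0 -> exists n, d w z (D n w) < e).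

Definition continuous_on {T : Type} (d : T -> T -> R) (f : T -> R) : Prop :=
  forall x e, e > 0 -> exists del, del > 0 /\
    forall y, d x y < del -> Rabs (f y - f x) < e.

(* eps in the set iff eps > 0 and sup_{x in B(x0,1/eps)} |f x - g x| < eps *)
Definition delta_set {T : Type} (d : T -> T -> R) (x0 : T) (f g : T -> R) (e : R) : Prop :=
  0 < e /\ exists M, M < e /\ forall x, d x0 x < / e -> Rabs (f x - g x) <= M.

Definition is_glb (S : R -> Prop) (m : R) : Prop :=
  (forall e, S e -> m <= e) /\ (forall m', (forall e, S e -> m' <= e) -> m' <= m).

Definition delta {T : Type} (d : T -> T -> R) (x0 : T) (f g : T -> R) : R :=
  epsilon (inhabits 0) (fun r => is_glb (delta_set d x0 f g) r).

Definition in_closure {T : Type} (d : T -> T -> R) (x0 : T)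
  (S : (T -> R) -> Prop) (f : T -> R) : Prop :=
  forall e, e > 0 -> exists g, S g /\ delta d x0 f g < e.

Definition in_C0 {T : Type} (d : T -> T -> R) (x0 : T) (f : T -> R) : Prop :=
  continuous_on d f /\ f x0 = 0.

Definition L_C0 {Om : Type} (A : (Om -> Prop) -> Prop) (X : Om -> Type)
  (d : forall w, X w -> X w -> R) (L : (forall w, X w) -> Prop) (x0 : forall w, X w)
  (f : forall w, X w -> R) : Prop :=
  (forall w, in_C0 (d w) (x0 w) (f w)) /\
  (forall x, L x -> borel_fun A (fun w => f w (x w))).

Definition borel_subfield_C0 {Om : Type} (A : (Om -> Prop) -> Prop) (X : Om -> Type)
  (d : forall w, X w -> X w -> R) (L : (forall w, X w) -> Prop) (x0 : forall w, X w)
  (B : forall w, (X w -> R) -> Prop) : Prop :=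
  (forall w f, B w f -> in_C0 (d w) (x0 w) f) /\
  A (fun w => exists f, B w f) /\
  exists y : nat -> forall w, X w -> R,
    (forall n, L_C0 A X d L x0 (y n)) /\
    forall w, (exists f, B w f) ->
      (forall n, B w (y n w)) /\
      (forall f, B w f -> in_closure (d w) (x0 w) (fun g => exists n, g = y n w) f).

Definition i_map {Om : Type} {X : Om -> Type} (d : forall w, X w -> X w -> R)
  (x0 : forall w, X w) (w : Om) (x : X w) : X w -> R :=
  fun z => d w x z - d w x (x0 w).

Definition iX {Om : Type} {X : Om -> Type} (d : forall w, X w -> X w -> R)
  (x0 : forall w, X w) (w : Om) (f : X w -> R) : Prop :=
  exists x : X w, forall z, f z = i_map d x0 w x z.

Definition cl_iX {Om : Type} {X : Om -> Type} (d : forall w, X w -> X w -> R)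
  (x0 : forall w, X w) (w : Om) (f : X w -> R) : Prop :=
  in_C0 (d w) (x0 w) f /\ in_closure (d w) (x0 w) (iX d x0 w) f.

Definition bdX {Om : Type} {X : Om -> Type} (d : forall w, X w -> X w -> R)
  (x0 : forall w, X w) (w : Om) (f : X w -> R) : Prop :=
  cl_iX d x0 w f /\ ~ iX d x0 w f.

(* Main.v *)
(* A limit [f] of functions [i(x_n)] is of the form [i(x)] exactly when the [x_n] can be
   kept in a ball, by compactness of balls and because [i(x_n)] takes the value [-r] at
   distance [r] from the base point on the geodesic to [x_n].  So the boundary consists of
   the limits of [i(x_n)] with [x_n] leaving every ball.

   The boundary is therefore described by a dense sequence [D] alone, and Borel sections of
   it are built from unbounded sets of indices [k].  By total boundedness, for each such set
   and each [j] there is [n] such that the [k] in the set with [i(D k)] close to [i(D n)] on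
   the ball of radius [j] still form an unbounded set; replacing the set by this subset and
   iterating, with [n] always taken least, the functions [i(D n)] converge to a boundary
   point.  As the choices are integer valued, they are measurable in [w]. *)
Require Import Defs.
From Stdlib Require Import Reals Lra Lia List Wf_nat Cantor Classical ClassicalEpsilon.
From Stdlib Require Import FunctionalExtensionality PropExtensionality.
Open Scope R_scope.

(** * Vanishing tolerances and an enumeration of the rationals *)

Definition tol (n : nat) : R := / (INR n + 1).

Lemma tol_pos n : 0 < tol n.
Proof. apply Rinv_0_lt_compat; pose proof (pos_INR n); lra. Qed.

Lemma tol_small e : 0 < e -> exists N, forall n, (N <= n)%nat -> tol n < e.
Proof.
  intros He. destruct (INR_unbounded (/ e)) as [N HN].
  exists N. intros n Hn. apply le_INR in Hn.
  unfold tol. rewrite <- (Rinv_inv e).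
  assert (0 < / e) by now apply Rinv_0_lt_compat.
  apply Rinv_lt_contravar; [apply Rmult_lt_0_compat|]; lra.
Qed.

(** Passage to the limit in an inequality whose error term vanishes. As [c] may have any sign, the
    proof scales by the positive number [Rabs c + 1]. *)
Lemma le_of_tol a b c : (exists N, forall n, (N <= n)%nat -> a <= b + c * tol n) -> a <= b.
Proof.
  intros [N HN]. apply Rnot_lt_le. intros Hlt.
  assert (Hc : 0 < Rabs c + 1) by (pose proof (Rabs_pos c); lra).
  destruct (tol_small ((a - b) / (Rabs c + 1))) as [M HM].
  { apply Rdiv_lt_0_compat; lra. }
  specialize (HN (max N M) (Nat.le_max_l _ _)).
  specialize (HM (max N M) (Nat.le_max_r _ _)).
  set (t := tol (max N M)) in *.
  assert (Ht : 0 < t) by apply tol_pos.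
  assert ((Rabs c + 1) * t < a - b).
  { apply (Rmult_lt_compat_l (Rabs c + 1)) in HM; [|lra].
    replace ((Rabs c + 1) * ((a - b) / (Rabs c + 1))) with (a - b) in HM by (field; lra).
    exact HM. }
  pose proof (Rmult_le_compat_r t c (Rabs c) (Rlt_le _ _ Ht) (Rle_abs c)). lra.
Qed.

(** Cantor pairing codes a numerator [p - q] and a denominator [b + 1] in one index, so every
    rational is listed, with repetitions. *)
Definition rat_enum (n : nat) : R :=
  let (a, b) := of_nat n in let (p, q) := of_nat a in (INR p - INR q) * tol b.

Lemma rat_enum_dense x y : x < y -> exists n, x < rat_enum n < y.
Proof.
  intros Hxy. destruct (tol_small (y - x)) as [b Hb]; [lra|].
  specialize (Hb b (le_n b)).
  pose (N := INR b + 1).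
  assert (HN : 0 < N) by (unfold N; pose proof (pos_INR b); lra).
  assert (HNt : N * tol b = 1) by (unfold tol; fold N; field; lra).
  destruct (archimed (x * N)) as [H1 H2].
  set (z := up (x * N)) in *.
  (* The witness is [z * tol b], the first multiple of [tol b] beyond [x]; the integer [z] enters
     through its positive and negative parts, one of which is 0. *)
  exists (to_nat (to_nat (Z.to_nat z, Z.to_nat (- z)), b)).
  unfold rat_enum. rewrite !cancel_of_to.
  replace (INR (Z.to_nat z) - INR (Z.to_nat (- z))) with (IZR z)
    by (rewrite !INR_IZR_INZ, <- minus_IZR; f_equal; lia).
  pose proof (tol_pos b) as Ht.
  split.
  - apply (Rmult_lt_compat_r (tol b)) in H1; [|assumption].
    rewrite Rmult_assoc, HNt, Rmult_1_r in H1. exact H1.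
  - assert (H3 : IZR z <= x * N + 1) by lra.
    apply (Rmult_le_compat_r (tol b)) in H3; [|lra].
    rewrite Rmult_plus_distr_r, Rmult_assoc, HNt in H3. lra.
Qed.

(** * Measurable sets and functions *)

Section Measurability.

Variables (Om : Type) (A : (Om -> Prop) -> Prop).
Hypothesis HA : sigma_algebra A.

Lemma sigma_ext (S T : Om -> Prop) : (forall w, S w <-> T w) -> A S -> A T.
Proof.
  intros H HS. replace T with S; [exact HS|].
  apply functional_extensionality. intros w. apply propositional_extensionality, H.
Qed.

Lemma sigma_not S : A S -> A (fun w => ~ S w).
Proof. apply HA. Qed.

Lemma sigma_ex (S : nat -> Om -> Prop) : (forall n, A (S n)) -> A (fun w => exists n, S n w).
Proof. apply HA. Qed.

Lemma sigma_const (P : Prop) : A (fun _ => P).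
Proof.
  destruct HA as [HT [HN _]]. destruct (classic P) as [HP|HP].
  - apply (sigma_ext (fun _ => True)); tauto.
  - apply (sigma_ext (fun _ => ~ True)); [tauto|]. now apply (HN (fun _ => True)).
Qed.

Lemma sigma_all (S : nat -> Om -> Prop) : (forall n, A (S n)) -> A (fun w => forall n, S n w).
Proof.
  intros HS. apply (sigma_ext (fun w => ~ exists n, ~ S n w)).
  - intros w. split; intros H; [|firstorder].
    intros n. apply NNPP. intros Hn. apply H. now exists n.
  - apply sigma_not, sigma_ex. intros n. now apply sigma_not.
Qed.

Lemma sigma_or S T : A S -> A T -> A (fun w => S w \/ T w).
Proof.
  intros HS HT. apply (sigma_ext (fun w => exists n : nat, match n with 0%nat => S w | _ => T w end)).
  - intros w. split.
    + intros [[|n] Hn]; tauto.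
    + intros [H|H]; [now exists 0%nat|now exists 1%nat].
  - apply (sigma_ex (fun n w => match n with 0%nat => S w | _ => T w end)). intros [|n]; assumption.
Qed.

Lemma sigma_and S T : A S -> A T -> A (fun w => S w /\ T w).
Proof.
  intros HS HT. apply (sigma_ext (fun w => ~ (~ S w \/ ~ T w))).
  - intros w. destruct (classic (S w)), (classic (T w)); tauto.
  - apply sigma_not, sigma_or; now apply sigma_not.
Qed.

Lemma sigma_imp S T : A S -> A T -> A (fun w => S w -> T w).
Proof.
  intros HS HT. apply (sigma_ext (fun w => ~ S w \/ T w)).
  - intros w. destruct (classic (S w)); tauto.
  - now apply sigma_or; [apply sigma_not|].
Qed.

Lemma borel_fun_open f U : borel_fun A f -> open_R U -> A (fun w => U (f w)).
Proof. intros Hf HU. apply Hf. intros Sig _ H. now apply H. Qed.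

Lemma borel_fun_lt f c : borel_fun A f -> A (fun w => f w < c).
Proof.
  intros Hf. apply (borel_fun_open f (fun x => x < c)); [assumption|].
  intros x Hx. exists (c - x). split; [lra|]. intros y Hy. apply Rabs_def2 in Hy. lra.
Qed.

Lemma borel_fun_gt f c : borel_fun A f -> A (fun w => c < f w).
Proof.
  intros Hf. apply (borel_fun_open f (fun x => c < x)); [assumption|].
  intros x Hx. exists (x - c). split; [lra|]. intros y Hy. apply Rabs_def2 in Hy. lra.
Qed.

Lemma borel_fun_le f c : borel_fun A f -> A (fun w => f w <= c).
Proof.
  intros Hf. apply (sigma_ext (fun w => ~ c < f w)); [intros w; lra|].
  now apply sigma_not, borel_fun_gt.
Qed.

Lemma borel_fun_Rabs_le f c : borel_fun A f -> A (fun w => Rabs (f w) <= c).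
Proof.
  intros Hf. apply (sigma_ext (fun w => f w <= c /\ ~ f w < - c)).
  - intros w. split.
    + intros [H1 H2]. apply Rabs_le. lra.
    + intros H. pose proof (Rle_abs (f w)). pose proof (Rle_abs (- f w)) as H'.
      rewrite Rabs_Ropp in H'. lra.
  - apply sigma_and; [now apply borel_fun_le|now apply sigma_not, borel_fun_lt].
Qed.

(** The sets with measurable preimage form a sigma-algebra, so open sets suffice, and an open set is
    the countable union of the rational intervals inside it. *)
Lemma borel_fun_of_lt f : (forall c, A (fun w => f w < c)) -> borel_fun A f.
Proof.
  intros Hf S HS. apply (HS (fun T => A (fun w => T (f w)))).
  - split; [apply sigma_const|split].
    + intros T. apply sigma_not.
    + intros T. apply (sigma_ex (fun n w => T n (f w))).
  - intros U HU.
    assert (Hge : forall c, A (fun w => c < f w)).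
    { intros c. apply (sigma_ext (fun w => exists n, ~ f w < c + tol n)).
      - intros w. split.
        + intros [n Hn]. pose proof (tol_pos n). lra.
        + intros H. destruct (tol_small (f w - c)) as [n Hn]; [lra|].
          exists n. specialize (Hn n (le_n n)). lra.
      - apply sigma_ex. intros n. apply sigma_not, Hf. }
    apply (sigma_ext (fun w => exists m n, (rat_enum m < f w /\ f w < rat_enum n) /\
      forall y, rat_enum m < y < rat_enum n -> U y)).
    + intros w. split.
      * intros (m & n & H & HUmn). now apply HUmn.
      * intros H. destruct (HU _ H) as (e & He & HUe).
        destruct (rat_enum_dense (f w - e) (f w)) as [m Hm]; [lra|].
        destruct (rat_enum_dense (f w) (f w + e)) as [n Hn]; [lra|].
        exists m, n. split; [lra|]. intros y Hy. apply HUe, Rabs_def1; lra.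
    + apply sigma_ex. intros m. apply (sigma_ex (fun n w => _)). intros n.
      apply sigma_and; [now apply sigma_and|apply sigma_const].
Qed.

(** A rational can be placed strictly between [f w] and [c + g w] exactly when the difference is
    below [c]. *)
Lemma borel_fun_minus f g : borel_fun A f -> borel_fun A g -> borel_fun A (fun w => f w - g w).
Proof.
  intros Hf Hg. apply borel_fun_of_lt. intros c.
  apply (sigma_ext (fun w => exists n, f w < rat_enum n /\ rat_enum n - c < g w)).
  - intros w. split.
    + intros [n Hn]. lra.
    + intros H. destruct (rat_enum_dense (f w) (c + g w)) as [n Hn]; [lra|]. exists n. lra.
  - apply sigma_ex. intros n.
    apply sigma_and; [now apply borel_fun_lt|now apply borel_fun_gt].
Qed.

(** The limit is below [c] iff the sequence eventually stays below [c] by some fixed margin [tol a],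
    a condition with countable quantifiers only. *)
Lemma borel_fun_cv u f :
  (forall n, borel_fun A (u n)) -> (forall w, Un_cv (fun n => u n w) (f w)) -> borel_fun A f.
Proof.
  intros Hu Hcv. apply borel_fun_of_lt. intros c.
  apply (sigma_ext (fun w => exists a N, forall n, (N <= n)%nat -> u n w < c - tol a)).
  - intros w. split.
    + intros (a & N & H). pose proof (tol_pos a).
      destruct (Hcv w (tol a)) as [M HM]; [lra|].
      specialize (H (max N M) (Nat.le_max_l _ _)).
      specialize (HM (max N M) (Nat.le_max_r _ _)).
      unfold Rdist in HM. apply Rabs_def2 in HM. lra.
    + intros H. destruct (tol_small ((c - f w) / 2)) as [a Ha]; [lra|].
      specialize (Ha a (le_n a)).
      destruct (Hcv w ((c - f w) / 2)) as [N HN]; [lra|].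
      exists a, N. intros n Hn. specialize (HN n Hn).
      unfold Rdist in HN. apply Rabs_def2 in HN. lra.
  - apply sigma_ex. intros a. apply (sigma_ex (fun N w => _)). intros N.
    apply (sigma_all (fun n w => _)). intros n.
    apply sigma_imp; [apply sigma_const|now apply borel_fun_lt].
Qed.

Lemma borel_fun_select (u : nat -> Om -> R) (k : Om -> nat) :
  (forall n, borel_fun A (u n)) -> (forall n, A (fun w => k w = n)) ->
  borel_fun A (fun w => u (k w) w).
Proof.
  intros Hu Hk S HS. apply (sigma_ext (fun w => exists n, k w = n /\ S (u n w))).
  - intros w. split; [now intros (n & <- & H)|now exists (k w)].
  - apply sigma_ex. intros n. apply sigma_and; [apply Hk|now apply Hu].
Qed.

End Measurability.
(** * Functions attached to points and their limits *)

Lemma tol_antitone m n : (m <= n)%nat -> tol n <= tol m.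
Proof.
  intros H. apply le_INR in H. pose proof (pos_INR m).
  apply Rinv_le_contravar; lra.
Qed.

Lemma Rabs_le_inv a b : Rabs a <= b -> - b <= a <= b.
Proof.
  intros H. pose proof (Rle_abs a). pose proof (Rle_abs (- a)) as H'.
  rewrite Rabs_Ropp in H'. lra.
Qed.

(** Keeps the radius and the tolerance apart, whereas [delta] ties them to one number. *)
Definition near_on {T : Type} (d : T -> T -> R) (x0 : T) (M e : R) (f g : T -> R) : Prop :=
  forall z, d x0 z < M -> Rabs (f z - g z) <= e.

Definition dist_fun {T : Type} (d : T -> T -> R) (x0 x z : T) : R := d x z - d x x0.

Definition is_dist_fun {T : Type} (d : T -> T -> R) (x0 : T) (f : T -> R) : Prop :=
  exists x, forall z, f z = dist_fun d x0 x z.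

(** Replaces the difference of sets [bdX] by a condition that passes to limits and can be tested on
    a dense sequence. *)
Definition ideal {T : Type} (d : T -> T -> R) (x0 : T) (f : T -> R) : Prop :=
  forall M e r, 0 < e -> exists x, r < d x0 x /\ near_on d x0 M e f (dist_fun d x0 x).

(* Equal to [0] when [P] is empty. *)
Definition least (P : nat -> Prop) : nat :=
  epsilon (inhabits 0%nat) (fun n =>
    (P n /\ forall m, (m < n)%nat -> ~ P m) \/ (n = 0%nat /\ forall m, ~ P m)).

Lemma least_spec P :
  (P (least P) /\ forall m, (m < least P)%nat -> ~ P m) \/ (least P = 0%nat /\ forall m, ~ P m).
Proof.
  unfold least. apply epsilon_spec. destruct (classic (exists m, P m)) as [HP|HP].
  - destruct (dec_inh_nat_subset_has_unique_least_element P) as (n & [Hn Hle] & _);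
      [intros n; apply classic|exact HP|].
    exists n. left. split; [exact Hn|]. intros m Hm HPm. specialize (Hle m HPm). lia.
  - exists 0%nat. right. split; [reflexivity|]. intros m Hm. apply HP. now exists m.
Qed.

(** Thanks to the default, the value is described by a countable Boolean combination of the [P m] in
    every case; measurability of integer choices rests on this. *)
Lemma least_iff P n :
  least P = n <->
  (P n /\ forall m, (m < n)%nat -> ~ P m) \/ (n = 0%nat /\ forall m, ~ P m).
Proof.
  split; [intros <-; apply least_spec|].
  destruct (least_spec P) as [[H1 H2]|[H1 H2]]; intros [[H3 H4]|[H3 H4]].
  - destruct (Nat.lt_trichotomy (least P) n) as [Hlt|[Heq|Hlt]]; [|exact Heq|].
    + now contradiction (H4 _ Hlt).
    + now contradiction (H2 _ Hlt).
  - now contradiction (H4 (least P)).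
  - now contradiction (H2 n).
  - congruence.
Qed.

Definition limit (u : nat -> R) : R := epsilon (inhabits 0) (Un_cv u).

Lemma Un_cv_near u l a e N :
  Un_cv u l -> (forall n, (N <= n)%nat -> Rabs (a - u n) <= e) -> Rabs (a - l) <= e.
Proof.
  intros Hu H. apply (le_of_tol _ _ 1). destruct (Hu (tol 0) (tol_pos 0)) as [M _].
  exists 0%nat. intros p _. destruct (Hu (tol p) (tol_pos p)) as [K HK].
  specialize (H (max N K) (Nat.le_max_l _ _)). specialize (HK (max N K) (Nat.le_max_r _ _)).
  unfold Rdist in HK.
  replace (a - l) with ((a - u (max N K)) + (u (max N K) - l)) by ring.
  pose proof (Rabs_triang (a - u (max N K)) (u (max N K) - l)). lra.
Qed.

Section MetricSpace.

Variables (T : Type) (d : T -> T -> R) (x0 : T).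
Hypothesis Hd : is_metric d.

Lemma dist_pos x y : 0 <= d x y.
Proof. apply Hd. Qed.

Lemma dist_refl x : d x x = 0.
Proof. now apply Hd. Qed.

Lemma dist_sym x y : d x y = d y x.
Proof. apply Hd. Qed.

Lemma dist_tri x y z : d x z <= d x y + d y z.
Proof. apply Hd. Qed.

Lemma near_on_sym M e f g : near_on d x0 M e f g -> near_on d x0 M e g f.
Proof. intros H z Hz. rewrite Rabs_minus_sym. now apply H. Qed.

Lemma near_on_trans M e1 e2 f g h :
  near_on d x0 M e1 f g -> near_on d x0 M e2 g h -> near_on d x0 M (e1 + e2) f h.
Proof.
  intros H1 H2 z Hz. replace (f z - h z) with ((f z - g z) + (g z - h z)) by ring.
  eapply Rle_trans; [apply Rabs_triang|]. apply Rplus_le_compat; auto.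
Qed.

Lemma near_on_weaken M M' e e' f g :
  M <= M' -> e' <= e -> near_on d x0 M' e' f g -> near_on d x0 M e f g.
Proof.
  intros HM He H z Hz. eapply Rle_trans; [apply H; lra|exact He].
Qed.

Lemma dist_fun_base x : dist_fun d x0 x x0 = 0.
Proof. unfold dist_fun. ring. Qed.

Lemma dist_fun_lipschitz x y z : Rabs (dist_fun d x0 x y - dist_fun d x0 x z) <= d y z.
Proof.
  unfold dist_fun. pose proof (dist_tri x y z). pose proof (dist_tri x z y).
  rewrite (dist_sym z y) in *. apply Rabs_le. lra.
Qed.

Lemma dist_fun_near x y z : Rabs (dist_fun d x0 x z - dist_fun d x0 y z) <= 2 * d x y.
Proof.
  unfold dist_fun. pose proof (dist_tri x y z). pose proof (dist_tri y x z).
  pose proof (dist_tri x y x0). pose proof (dist_tri y x x0).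
  rewrite (dist_sym y x) in *. apply Rabs_le. lra.
Qed.

Lemma in_C0_lipschitz f : (forall y z, Rabs (f y - f z) <= d y z) -> f x0 = 0 -> in_C0 d x0 f.
Proof.
  intros Hf H0. split; [|exact H0]. intros x e He. exists e. split; [exact He|].
  intros y Hy. eapply Rle_lt_trans; [apply Hf|]. now rewrite dist_sym.
Qed.

Lemma in_C0_dist_fun x : in_C0 d x0 (dist_fun d x0 x).
Proof. apply in_C0_lipschitz; [apply dist_fun_lipschitz|apply dist_fun_base]. Qed.

Lemma in_C0_is_dist_fun f : is_dist_fun d x0 f -> in_C0 d x0 f.
Proof.
  intros [x Hx]. replace f with (dist_fun d x0 x); [apply in_C0_dist_fun|].
  apply functional_extensionality. intros z. now rewrite Hx.
Qed.

(** * The metric [delta] and closures *)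

(** As [delta] is defined by [epsilon], an infimum must be shown to exist. It is minus the supremum
    of the negated set, which is bounded above by 0; the set is inhabited since both functions
    vanish at [x0] and stay small near it. *)
Lemma is_glb_delta f g : in_C0 d x0 f -> in_C0 d x0 g ->
  is_glb (delta_set d x0 f g) (delta d x0 f g).
Proof.
  intros [Hf Hf0] [Hg Hg0]. unfold delta. apply epsilon_spec.
  destruct (Hf x0 (1/4)) as (r1 & Hr1 & H1); [lra|].
  destruct (Hg x0 (1/4)) as (r2 & Hr2 & H2); [lra|].
  pose (r := Rmin r1 r2).
  assert (Hr : 0 < r) by now apply Rmin_pos.
  destruct (completeness (fun x => delta_set d x0 f g (- x))) as [m [Hm1 Hm2]].
  - exists 0. intros x [Hx _]. lra.
  (* For the value [1 + / r] the ball to be tested lies within radius [r], where both functions are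
     below 1/4 in absolute value. *)
  - exists (- (1 + / r)). rewrite Ropp_involutive.
    assert (Hir : 0 < / r) by now apply Rinv_0_lt_compat.
    split; [lra|]. exists (1/2). split; [lra|]. intros x Hx.
    assert (Hxr : d x0 x < r).
    { eapply Rlt_trans; [exact Hx|]. rewrite <- (Rinv_inv r) at 2.
      apply Rinv_lt_contravar; [apply Rmult_lt_0_compat|]; lra. }
    pose proof (Rmin_l r1 r2). pose proof (Rmin_r r1 r2). fold r in H, H0.
    assert (h1 : d x0 x < r1) by lra. assert (h2 : d x0 x < r2) by lra.
    apply H1, Rabs_def2 in h1. apply H2, Rabs_def2 in h2.
    rewrite Hf0 in h1. rewrite Hg0 in h2. apply Rabs_le. lra.
  - exists (- m). split.
    + intros e He. enough (- e <= m) by lra. apply Hm1. now rewrite Ropp_involutive.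
    + intros m' Hm'. enough (m <= - m') by lra. apply Hm2.
      intros x Hx. specialize (Hm' _ Hx). lra.
Qed.

Lemma in_closure_iff (S : (T -> R) -> Prop) f :
  in_C0 d x0 f -> (forall g, S g -> in_C0 d x0 g) ->
  in_closure d x0 S f <-> forall M e, 0 < e -> exists g, S g /\ near_on d x0 M e f g.
Proof.
  intros Hf HS. split.
  - intros Hcl M e He.
    pose proof (Rabs_pos M). pose proof (Rle_abs M).
    assert (HM : 0 < / (Rabs M + 1)) by (apply Rinv_0_lt_compat; lra).
    (* An element of [delta_set] below this minimum controls a ball of radius larger than [M], with
       a bound smaller than [e]. *)
    destruct (Hcl (Rmin e (/ (Rabs M + 1)))) as (g & Hg & Hlt); [now apply Rmin_pos|].
    exists g. split; [exact Hg|].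
    destruct (is_glb_delta f g Hf (HS g Hg)) as [_ Hglb].
    apply NNPP. intros Hn. apply (Rlt_not_le _ _ Hlt). apply Hglb.
    intros e' (He' & b & Hb & Hnear). apply Rnot_lt_le. intros Hlt'. apply Hn.
    pose proof (Rmin_l e (/ (Rabs M + 1))). pose proof (Rmin_r e (/ (Rabs M + 1))).
    assert (M < / e').
    { apply Rlt_trans with (Rabs M + 1); [lra|]. rewrite <- (Rinv_inv (Rabs M + 1)).
      apply Rinv_lt_contravar; [apply Rmult_lt_0_compat|]; lra. }
    intros z Hz. eapply Rle_trans; [apply Hnear; lra|lra].
  - intros H e He. destruct (H (/ (e / 2)) (e / 4)) as (g & Hg & Hnear); [lra|].
    exists g. split; [exact Hg|]. apply Rle_lt_trans with (e / 2); [|lra].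
    apply (is_glb_delta f g Hf (HS g Hg)). split; [lra|].
    exists (e / 4). split; [lra|exact Hnear].
Qed.

(* If the points were confined to a closed ball, compactness would produce one
   of them representing [f]. *)
Lemma ideal_of_limit f :
  proper_space d -> in_closure d x0 (is_dist_fun d x0) f -> in_C0 d x0 f ->
  ~ is_dist_fun d x0 f -> ideal d x0 f.
Proof.
  intros Hprop Hcl HC Hnot M e r He. apply NNPP. intros Hfar.
  rewrite in_closure_iff in Hcl by (assumption || apply in_C0_is_dist_fun).
  (* The [j]-th open set consists of the points whose function misses [f] by more than [tol j]
     somewhere in the ball of radius [j]. These sets cover because no point represents [f]. *)
  destruct (Hprop x0 r nat (fun j x => exists z, d x0 z < INR j /\
    tol j < Rabs (f z - dist_fun d x0 x z))) as [l Hl].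
  - intros j x (z & Hz & Hlt).
    (* Half of the slack, because the attached function moves by at most twice the distance of the
       points. *)
    exists ((Rabs (f z - dist_fun d x0 x z) - tol j) / 2). split; [lra|].
    intros y Hy. exists z. split; [exact Hz|].
    pose proof (dist_fun_near x y z) as H1.
    pose proof (Rabs_triang (f z - dist_fun d x0 y z) (dist_fun d x0 y z - dist_fun d x0 x z)) as H2.
    replace (f z - dist_fun d x0 y z + (dist_fun d x0 y z - dist_fun d x0 x z))
      with (f z - dist_fun d x0 x z) in H2 by ring.
    rewrite (Rabs_minus_sym (dist_fun d x0 y z)) in H2. lra.
  - intros x _. apply NNPP. intros Hx. apply Hnot. exists x. intros z.
    apply NNPP. intros Hne.
    assert (Hpos : 0 < Rabs (f z - dist_fun d x0 x z)) by (apply Rabs_pos_lt; lra).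
    destruct (tol_small _ Hpos) as [N HN]. destruct (INR_unbounded (d x0 z)) as [K HK].
    apply Hx. exists (max N K), z. split; [|apply HN, Nat.le_max_l].
    pose proof (le_INR K (max N K) (Nat.le_max_r _ _)). lra.
  (* An approximation within [tol N] on radius [N] contradicts every member of the finite subcover
     at once. *)
  - pose (N := list_max l).
    destruct (Hcl (Rmax M (INR N)) (Rmin e (tol N))) as (g & [x Hx] & Hnear).
    { apply Rmin_pos; [exact He|apply tol_pos]. }
    replace g with (dist_fun d x0 x) in Hnear
      by (apply functional_extensionality; intros z; now rewrite Hx).
    destruct (Hl x) as (j & Hj & z & Hz & Hlt).
    + apply Rnot_lt_le. intros Hr. apply Hfar. exists x. split; [exact Hr|].
      eapply near_on_weaken; [apply Rmax_l|apply Rmin_l|exact Hnear].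
    + assert (HjN : (j <= N)%nat).
      { pose proof (proj1 (list_max_le l N) (le_n N)) as HF.
        rewrite Forall_forall in HF. now apply HF. }
      pose proof (tol_antitone j N HjN). pose proof (le_INR j N HjN).
      pose proof (Rmax_r M (INR N)). pose proof (Rmin_r e (tol N)).
      assert (Hz' : d x0 z < Rmax M (INR N)) by lra.
      specialize (Hnear z Hz'). lra.
Qed.

Lemma in_closure_ideal f : in_C0 d x0 f -> ideal d x0 f -> in_closure d x0 (is_dist_fun d x0) f.
Proof.
  intros HC Hf. apply in_closure_iff; [exact HC|apply in_C0_is_dist_fun|].
  intros M e He. destruct (Hf M e 0 He) as (x & _ & Hx).
  exists (dist_fun d x0 x). split; [now exists x|exact Hx].
Qed.

(* Along the geodesic from [x0] to a far away point [y], the function attached to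
   [y] takes the value [-r] at distance [r]; hence [f] is unbounded below, while
   the function attached to [x] is bounded below by [- d x x0]. *)
Lemma not_dist_fun_ideal f :
  (forall x y, exists g, geodesic_path d x y g) -> ideal d x0 f -> ~ is_dist_fun d x0 f.
Proof.
  intros Hgeo Hf [x Hx]. pose (r := d x x0 + 1).
  pose proof (dist_pos x x0) as Hpos.
  destruct (Hf (r + 1) (1/2) r) as (y & Hy & Hnear); [lra|].
  destruct (Hgeo x0 y) as (g & Hg0 & Hg1 & Hg).
  pose (s := r / d x0 y).
  assert (Hr : 0 < r) by (unfold r; lra).
  assert (Hsr : s * d x0 y = r) by (unfold s; field; lra).
  assert (Hs : 0 < s) by (apply Rdiv_lt_0_compat; lra).
  assert (Hs1 : s < 1).
  { apply (Rmult_lt_reg_r (d x0 y)); lra. }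
  assert (H0 : d x0 (g s) = r).
  { rewrite <- Hg0 at 1. rewrite Hg by lra. rewrite Rabs_left; lra. }
  assert (H1 : d y (g s) = d x0 y - r).
  { rewrite <- Hg1 at 1. rewrite Hg by lra. rewrite Rabs_right; lra. }
  specialize (Hnear (g s)). rewrite H0 in Hnear. specialize (Hnear ltac:(lra)).
  rewrite Hx in Hnear. unfold dist_fun in Hnear. rewrite H1, (dist_sym y x0) in Hnear.
  pose proof (dist_pos x (g s)). pose proof (Rle_abs (d x (g s) - d x x0 - (d x0 y - r - d x0 y))).
  unfold r in *. lra.
Qed.

Lemma ideal_closed f :
  (forall M e, 0 < e -> exists g, ideal d x0 g /\ near_on d x0 M e f g) -> ideal d x0 f.
Proof.
  intros H M e r He. destruct (H M (e / 2)) as (g & Hg & Hfg); [lra|].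
  destruct (Hg M (e / 2) r) as (x & Hr & Hgx); [lra|].
  exists x. split; [exact Hr|]. replace e with (e / 2 + e / 2) by field.
  now apply near_on_trans with g.
Qed.

Variable D : nat -> T.
Hypothesis HD : forall z e, e > 0 -> exists n, d z (D n) < e.

Lemma dist_fun_dense x e : 0 < e ->
  exists n, d x (D n) < e /\ forall M, near_on d x0 M e (dist_fun d x0 x) (dist_fun d x0 (D n)).
Proof.
  intros He. destruct (HD x (e / 2)) as [n Hn]; [lra|].
  exists n. split; [lra|]. intros M z _.
  eapply Rle_trans; [apply dist_fun_near|]. lra.
Qed.

Lemma ideal_dense f M e r : ideal d x0 f -> 0 < e ->
  exists n, r < d x0 (D n) /\ near_on d x0 M e f (dist_fun d x0 (D n)).
Proof.
  (* The surplus [e / 2] in the distance pays for moving [x] to a point of the dense sequence. *)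
  intros Hf He. destruct (Hf M (e / 2) (r + e / 2)) as (x & Hr & Hx); [lra|].
  destruct (dist_fun_dense x (e / 2)) as (n & Hn & Hxn); [lra|].
  exists n. split.
  - pose proof (dist_tri x0 (D n) x). rewrite (dist_sym (D n) x) in *. lra.
  - replace e with (e / 2 + e / 2) by field. now apply near_on_trans with (dist_fun d x0 x).
Qed.

(** * Selecting ideal functions *)

(** Refers to the points [D k], not to the size of the indices. *)
Definition unbounded (S : nat -> Prop) : Prop :=
  forall r : nat, exists k, S k /\ INR r < d x0 (D k).

(** Tested only at points of [D], so that it is a countable condition; by continuity nothing is
    lost. *)
Definition near (j n k : nat) : Prop :=
  forall m, d x0 (D m) < INR j ->
    Rabs (dist_fun d x0 (D n) (D m) - dist_fun d x0 (D k) (D m)) <= tol j.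

(** Both functions are 1-Lipschitz, so replacing [z] by a point of [D] within [tol p] costs
    [2 * tol p], and for large [p] that point is still in the open ball. *)
Lemma near_on_of_near j n k : near j n k ->
  near_on d x0 (INR j) (tol j) (dist_fun d x0 (D n)) (dist_fun d x0 (D k)).
Proof.
  intros H z Hz. apply (le_of_tol _ _ 2).
  destruct (tol_small (INR j - d x0 z)) as [N HN]; [lra|].
  exists N. intros p Hp. specialize (HN p Hp).
  destruct (HD z (tol p)) as [m Hm]; [apply tol_pos|].
  pose proof (dist_tri x0 z (D m)).
  specialize (H m ltac:(lra)).
  pose proof (dist_fun_lipschitz (D n) z (D m)) as H1.
  pose proof (dist_fun_lipschitz (D k) (D m) z) as H2.
  rewrite (dist_sym (D m) z) in H2.
  set (a := dist_fun d x0 (D n) z) in *. set (b := dist_fun d x0 (D n) (D m)) in *.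
  set (a' := dist_fun d x0 (D k) z) in *. set (b' := dist_fun d x0 (D k) (D m)) in *.
  replace (a - a') with ((a - b) + (b - b') + (b' - a')) by ring.
  pose proof (Rabs_triang (a - b + (b - b')) (b' - a')).
  pose proof (Rabs_triang (a - b) (b - b')). lra.
Qed.

Lemma near_of_near_on j n k :
  near_on d x0 (INR j) (tol j) (dist_fun d x0 (D n)) (dist_fun d x0 (D k)) -> near j n k.
Proof. intros H m Hm. now apply H. Qed.

(** * Pigeonhole principle for unbounded index sets *)

Lemma unbounded_mono (S S' : nat -> Prop) : (forall k, S k -> S' k) -> unbounded S -> unbounded S'.
Proof. intros H HS r. destruct (HS r) as (k & Hk & Hr). exists k. auto. Qed.

Lemma unbounded_or (S S' : nat -> Prop) :
  unbounded (fun k => S k \/ S' k) -> unbounded S \/ unbounded S'.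
Proof.
  intros H. apply NNPP. intros Hn. apply not_or_and in Hn. destruct Hn as [H1 H2].
  apply not_all_ex_not in H1. destruct H1 as [r1 H1].
  apply not_all_ex_not in H2. destruct H2 as [r2 H2].
  destruct (H (max r1 r2)) as (k & Hk & Hr).
  pose proof (le_INR _ _ (Nat.le_max_l r1 r2)). pose proof (le_INR _ _ (Nat.le_max_r r1 r2)).
  destruct Hk as [Hk|Hk]; [apply H1|apply H2]; exists k; split; (assumption || lra).
Qed.

(** The range is cut into [N] pieces of length [e], split off one at a time from the left; one of
    them has an unbounded preimage. *)
Lemma unbounded_refine (h : nat -> R) e N : 0 < e -> forall a S,
  unbounded S -> (forall k, S k -> a <= h k <= a + INR N * e) ->
  exists S', unbounded S' /\ (forall k, S' k -> S k) /\
    forall k k', S' k -> S' k' -> Rabs (h k - h k') <= e.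
Proof.
  intros He. induction N as [|N IH]; intros a S HS Hh.
  - exists S. split; [exact HS|split; [auto|]]. intros k k' Hk Hk'.
    apply Hh in Hk. apply Hh in Hk'. simpl in *. apply Rabs_le. lra.
  - destruct (unbounded_or (fun k => S k /\ h k <= a + e) (fun k => S k /\ a + e < h k)) as [H|H].
    + apply unbounded_mono with S; [|exact HS].
      intros k Hk. destruct (Rle_or_lt (h k) (a + e)); tauto.
    + exists (fun k => S k /\ h k <= a + e). split; [exact H|split; [tauto|]].
      intros k k' [Hk ?] [Hk' ?]. apply Hh in Hk. apply Hh in Hk'. apply Rabs_le. lra.
    + destruct (IH (a + e) _ H) as (S' & HS' & Hsub & Hosc).
      * intros k [Hk ?]. apply Hh in Hk. rewrite S_INR in Hk. lra.
      * exists S'. split; [exact HS'|split; [|exact Hosc]]. intros k Hk. now apply Hsub.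
Qed.

(** One refinement per point [p]: the values at [p] lie between [- d x0 p] and [d x0 p], whence the
    number of pieces. *)
Lemma unbounded_refine_list (l : list T) e S : 0 < e -> unbounded S ->
  exists S', unbounded S' /\ (forall k, S' k -> S k) /\
    forall p k k', In p l -> S' k -> S' k' ->
      Rabs (dist_fun d x0 (D k) p - dist_fun d x0 (D k') p) <= e.
Proof.
  intros He. revert S. induction l as [|p l IH]; intros S HS.
  - exists S. split; [exact HS|split; [auto|]]. intros p k k' [].
  - destruct (IH S HS) as (S1 & HS1 & Hsub1 & Hosc1).
    destruct (INR_unbounded (2 * d x0 p / e)) as [N HN].
    destruct (unbounded_refine (fun k => dist_fun d x0 (D k) p) e N He (- d x0 p) S1 HS1)
      as (S2 & HS2 & Hsub2 & Hosc2).
    + intros k _. pose proof (dist_fun_lipschitz (D k) p x0) as H.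
      rewrite dist_fun_base, Rminus_0_r, dist_sym in H.
      apply Rabs_le_inv in H.
      apply (Rmult_lt_compat_r e) in HN; [|exact He].
      replace (2 * d x0 p / e * e) with (2 * d x0 p) in HN by (field; lra). lra.
    + exists S2. split; [exact HS2|split; [auto|]].
      intros q k k' [<-|Hq] Hk Hk'; [now apply Hosc2|].
      apply Hosc1; auto.
Qed.

Hypothesis Hprop : proper_space d.

(** A finite net of mesh [tol j / 4] in the ball and oscillation [tol j / 2] on the net give [tol j]
    in total. Any index in the refined set serves as [n]. *)
Lemma unbounded_near S j : unbounded S -> exists n, unbounded (fun k => S k /\ near j n k).
Proof.
  intros HS. pose proof (tol_pos j) as Ht.
  destruct (Hprop x0 (INR j) T (fun p y => d p y < tol j / 4)) as [l Hl].
  - intros p y Hy. exists (tol j / 4 - d p y). split; [lra|].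
    intros z Hz. pose proof (dist_tri p y z). lra.
  - intros x _. exists x. rewrite dist_refl. lra.
  - destruct (unbounded_refine_list l (tol j / 2) S) as (S' & HS' & Hsub & Hosc); [lra|exact HS|].
    destruct (HS' 0%nat) as (n & Hn & _). exists n.
    apply unbounded_mono with S'; [|exact HS']. intros k Hk. split; [auto|].
    apply near_of_near_on. intros z Hz.
    destruct (Hl z ltac:(lra)) as (p & Hp & Hpz).
    specialize (Hosc p n k Hp Hn Hk).
    pose proof (dist_fun_lipschitz (D n) z p) as H1.
    pose proof (dist_fun_lipschitz (D k) p z) as H2.
    rewrite (dist_sym z p) in H1.
    set (a := dist_fun d x0 (D n) z) in *. set (b := dist_fun d x0 (D n) p) in *.
    set (a' := dist_fun d x0 (D k) z) in *. set (b' := dist_fun d x0 (D k) p) in *.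
    replace (a - a') with ((a - b) + (b - b') + (b' - a')) by ring.
    pose proof (Rabs_triang (a - b + (b - b')) (b' - a')).
    pose proof (Rabs_triang (a - b) (b - b')). lra.
Qed.

(* [pick S j] is the least index whose function is [tol j]-close on the ball of
   radius [j] to those of an unbounded part of [tail S j], which becomes [tail S (S j)]. *)
Fixpoint tail (S : nat -> Prop) (j : nat) : nat -> Prop :=
  match j with
  | 0%nat => S
  | Datatypes.S i => fun k =>
      tail S i k /\ near i (least (fun n => unbounded (fun k => tail S i k /\ near i n k))) k
  end.

Definition pick (S : nat -> Prop) (j : nat) : nat :=
  least (fun n => unbounded (fun k => tail S j k /\ near j n k)).

Definition selection (S : nat -> Prop) (z : T) : R :=
  limit (fun j => dist_fun d x0 (D (pick S j)) z).

Lemma unbounded_tail S j : unbounded S -> unbounded (tail S j).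
Proof.
  intros HS. induction j as [|j IH]; [exact HS|]. simpl.
  destruct (least_spec (fun n => unbounded (fun k => tail S j k /\ near j n k)))
    as [[H _]|[_ H]]; [exact H|].
  destruct (unbounded_near _ j IH) as [n Hn]. now contradiction (H n).
Qed.

Lemma tail_incl S i j k : (i <= j)%nat -> tail S j k -> tail S i k.
Proof. induction 1 as [|j Hij IH]; [auto|]. intros [Hk _]. auto. Qed.

Lemma near_on_pick_tail S i j k : (i < j)%nat -> tail S j k ->
  near_on d x0 (INR i) (tol i) (dist_fun d x0 (D (pick S i))) (dist_fun d x0 (D k)).
Proof. intros Hij Hk. apply near_on_of_near. exact (proj2 (tail_incl S (Datatypes.S i) j k Hij Hk)). Qed.

(** Both functions are compared with that of one index in a later tail, which is inhabited because
    tails stay unbounded. *)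
Lemma near_on_pick S i j : unbounded S -> (i <= j)%nat ->
  near_on d x0 (INR i) (2 * tol i)
    (dist_fun d x0 (D (pick S i))) (dist_fun d x0 (D (pick S j))).
Proof.
  intros HS Hij. destruct (unbounded_tail S (Datatypes.S j) HS 0%nat) as (k & Hk & _).
  replace (2 * tol i) with (tol i + tol i) by ring.
  apply near_on_trans with (dist_fun d x0 (D k)).
  - apply near_on_pick_tail with (Datatypes.S j); [lia|exact Hk].
  - apply near_on_sym. apply near_on_weaken with (INR j) (tol j); [now apply le_INR|now apply tol_antitone|].
    apply near_on_pick_tail with (Datatypes.S j); [lia|exact Hk].
Qed.

(** Without candidates each choice falls back to 0. The sequence is then constant, so [selection] is
    a limit for every index set and needs no case distinction in the parameter. *)
Lemma pick_bounded S j : ~ unbounded S -> pick S j = 0%nat.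
Proof.
  intros HS. apply least_iff. right. split; [reflexivity|]. intros m H. apply HS.
  revert H. apply unbounded_mono. intros k [Hk _]. exact (tail_incl S 0 j k (Nat.le_0_l j) Hk).
Qed.

Lemma selection_cv S z :
  Un_cv (fun j => dist_fun d x0 (D (pick S j)) z) (selection S z).
Proof.
  unfold selection, limit. apply epsilon_spec.
  destruct (classic (unbounded S)) as [HS|HS].
  - destruct (R_complete (fun j => dist_fun d x0 (D (pick S j)) z)) as [l Hl]; [|now exists l].
    intros e He. destruct (tol_small (e / 4)) as [N HN]; [lra|].
    destruct (INR_unbounded (d x0 z)) as [K HK].
    exists (max N K).
    assert (H : forall n, (max N K <= n)%nat ->
      Rabs (dist_fun d x0 (D (pick S (max N K))) z - dist_fun d x0 (D (pick S n)) z) < e / 2).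
    { intros n Hn. eapply Rle_lt_trans; [apply (near_on_pick S (max N K) n HS Hn)|].
      - pose proof (le_INR K (max N K) (Nat.le_max_r _ _)). lra.
      - specialize (HN (max N K) (Nat.le_max_l _ _)). lra. }
    intros n m Hn Hm. unfold Rdist. apply H in Hn. apply H in Hm.
    apply Rabs_def2 in Hn. apply Rabs_def2 in Hm. apply Rabs_def1; lra.
  - exists (dist_fun d x0 (D 0%nat) z). intros e He. exists 0%nat. intros n _.
    rewrite pick_bounded by exact HS. unfold Rdist. rewrite Rminus_diag, Rabs_R0. exact He.
Qed.

Lemma in_C0_selection S : in_C0 d x0 (selection S).
Proof.
  apply in_C0_lipschitz.
  (* [Un_cv_near] bounds the distance from a fixed number to a limit; that number is 0 here. *)
  - intros y z. cut (Rabs (0 - (selection S y - selection S z)) <= d y z).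
    { now rewrite Rminus_0_l, Rabs_Ropp. }
    apply (Un_cv_near (fun j => dist_fun d x0 (D (pick S j)) y - dist_fun d x0 (D (pick S j)) z)
      _ _ _ 0%nat).
    + apply CV_minus; apply selection_cv.
    + intros n _. rewrite Rminus_0_l, Rabs_Ropp. apply dist_fun_lipschitz.
  - apply (UL_sequence (fun j => dist_fun d x0 (D (pick S j)) x0)); [apply selection_cv|].
    intros e He. exists 0%nat. intros n _. rewrite dist_fun_base.
    unfold Rdist. now rewrite Rminus_diag, Rabs_R0.
Qed.

(** Stage [j + 1] of the tail is the first to record closeness to [pick S j]; the limit adds
    [2 * tol j]. *)
Lemma near_on_selection S j k : unbounded S -> tail S (Datatypes.S j) k ->
  near_on d x0 (INR j) (3 * tol j) (selection S) (dist_fun d x0 (D k)).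
Proof.
  intros HS Hk. replace (3 * tol j) with (2 * tol j + tol j) by ring.
  apply near_on_trans with (dist_fun d x0 (D (pick S j))).
  - apply near_on_sym. intros z Hz.
    apply (Un_cv_near _ _ _ _ j (selection_cv S z)).
    intros n Hn. now apply near_on_pick.
  - now apply near_on_pick_tail with (Datatypes.S j); [lia|].
Qed.

Lemma ideal_selection S : unbounded S -> ideal d x0 (selection S).
Proof.
  intros HS M e r He. destruct (tol_small (e / 3)) as [N HN]; [lra|].
  destruct (INR_unbounded M) as [K HK]. pose (j := max N K).
  specialize (HN j (Nat.le_max_l _ _)). pose proof (le_INR K j (Nat.le_max_r _ _)).
  destruct (INR_unbounded r) as [q Hq].
  destruct (unbounded_tail S (Datatypes.S j) HS q) as (k & Hk & Hr).
  exists (D k). split; [lra|].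
  apply near_on_weaken with (INR j) (3 * tol j); [lra|lra|].
  now apply near_on_selection.
Qed.

(** Every tail stays inside [S], so a bound valid on all of [S] survives the limit. This ties a
    selection to its starting set. *)
Lemma near_on_selection_start S M e g : unbounded S ->
  (forall k, S k -> near_on d x0 M e g (dist_fun d x0 (D k))) ->
  near_on d x0 M e g (selection S).
Proof.
  intros HS Hg z Hz. apply (le_of_tol _ _ 3).
  destruct (INR_unbounded (d x0 z)) as [N HN]. exists N. intros j Hj. apply le_INR in Hj.
  destruct (unbounded_tail S (Datatypes.S j) HS 0%nat) as (k & Hk & _).
  pose proof (Hg k (tail_incl S 0 _ k (Nat.le_0_l _) Hk) z Hz) as H1.
  pose proof (near_on_selection S j k HS Hk z ltac:(lra)) as H2.
  rewrite Rabs_minus_sym in H2.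
  replace (g z - selection S z) with
    ((g z - dist_fun d x0 (D k) z) + (dist_fun d x0 (D k) z - selection S z)) by ring.
  eapply Rle_trans; [apply Rabs_triang|]. lra.
Qed.

(* The second alternative makes the set unbounded for every [c], as soon as the space is. *)
Definition start (c : nat) (k : nat) : Prop :=
  let (n, M) := of_nat c in near M n k \/ ~ unbounded (near M n).

Lemma unbounded_start c : unbounded (fun _ => True) -> unbounded (start c).
Proof.
  intros H. unfold start. destruct (of_nat c) as [n M].
  destruct (classic (unbounded (near M n))) as [Hn|Hn].
  - apply unbounded_mono with (near M n); [tauto|exact Hn].
  - apply unbounded_mono with (fun _ => True); [tauto|exact H].
Qed.

Lemma unbounded_of_ideal f : ideal d x0 f -> unbounded (fun _ => True).
Proof.
  intros Hf r. destruct (ideal_dense f 0 1 (INR r) Hf) as (k & Hk & _); [lra|]. now exists k.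
Qed.

(** Take [D n] close to [f]. Far points approximating [f] are then close to [D n] as well, so the
    set coded by [(n, j)] is unbounded, and its selection stays near [D n]. *)
Lemma selection_start_dense f M e : ideal d x0 f -> 0 < e ->
  exists c, near_on d x0 M e f (selection (start c)).
Proof.
  intros Hf He. destruct (tol_small (e / 2)) as [N HN]; [lra|].
  destruct (INR_unbounded M) as [K HK]. pose (j := max N K).
  specialize (HN j (Nat.le_max_l _ _)). pose proof (le_INR K j (Nat.le_max_r _ _)).
  pose proof (tol_pos j).
  destruct (ideal_dense f (INR j) (tol j / 2) 0 Hf) as (n & _ & Hn); [lra|].
  assert (Hunb : unbounded (near j n)).
  { intros r. destruct (ideal_dense f (INR j) (tol j / 2) (INR r) Hf) as (k & Hr & Hk); [lra|].
    exists k. split; [|exact Hr]. apply near_of_near_on.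
    replace (tol j) with (tol j / 2 + tol j / 2) by field.
    apply near_on_trans with f; [now apply near_on_sym|exact Hk]. }
  exists (to_nat (n, j)).
  apply near_on_weaken with (INR j) (tol j / 2 + tol j); [lra..|].
  apply near_on_trans with (dist_fun d x0 (D n)); [exact Hn|].
  apply near_on_selection_start.
  - apply unbounded_start. now apply unbounded_of_ideal with f.
  - intros k. unfold start. rewrite cancel_of_to.
    intros [Hk|Hk]; [now apply near_on_of_near|contradiction].
Qed.

End MetricSpace.
(** * Borel dependence on the parameter *)

Arguments unbounded {T} d x0 D S.
Arguments near {T} d x0 D j n k.
Arguments tail {T} d x0 D S j k.
Arguments pick {T} d x0 D S j.
Arguments selection {T} d x0 D S z.
Arguments start {T} d x0 D c k.

Section BorelField.

Variables (Om : Type) (A : (Om -> Prop) -> Prop) (X : Om -> Type)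
  (d : forall w, X w -> X w -> R) (L : (forall w, X w) -> Prop)
  (x0 : forall w, X w) (D : nat -> forall w, X w).
Hypothesis HA : sigma_algebra A.
Hypothesis HL : forall x y, L x -> L y -> borel_fun A (fun w => d w (x w) (y w)).
Hypothesis Hx0 : L x0.
Hypothesis HD : forall n, L (D n).

Lemma borel_dist_fun x y : L x -> L y ->
  borel_fun A (fun w => dist_fun (d w) (x0 w) (x w) (y w)).
Proof. intros Hx Hy. apply (borel_fun_minus _ _ HA); now apply HL. Qed.

Lemma measurable_unbounded (S : Om -> nat -> Prop) : (forall k, A (fun w => S w k)) ->
  A (fun w => unbounded (d w) (x0 w) (fun n => D n w) (S w)).
Proof.
  intros HS. apply (sigma_all _ _ HA (fun r w => _)). intros r.
  apply (sigma_ex _ _ HA (fun k w => _)). intros k.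
  apply (sigma_and _ _ HA); [apply HS|]. apply (borel_fun_gt _ _). now apply HL.
Qed.

Lemma measurable_near j n k : A (fun w => near (d w) (x0 w) (fun n => D n w) j n k).
Proof.
  apply (sigma_all _ _ HA (fun m w => _)). intros m. apply (sigma_imp _ _ HA).
  - apply borel_fun_lt. now apply HL.
  - apply (borel_fun_Rabs_le _ _ HA). apply (borel_fun_minus _ _ HA); now apply borel_dist_fun.
Qed.

Lemma measurable_least (P : Om -> nat -> Prop) n :
  (forall m, A (fun w => P w m)) -> A (fun w => least (P w) = n).
Proof.
  intros HP. apply (sigma_ext _ _ (fun w => (P w n /\ forall m, (m < n)%nat -> ~ P w m) \/
    (n = 0%nat /\ forall m, ~ P w m))).
  { intros w. now rewrite least_iff. }
  apply (sigma_or _ _ HA); apply (sigma_and _ _ HA);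
    (apply HP || apply (sigma_const _ _ HA) || apply (sigma_all _ _ HA (fun m w => _)); intros m).
  - apply (sigma_imp _ _ HA); [apply (sigma_const _ _ HA)|apply (sigma_not _ _ HA), HP].
  - apply (sigma_not _ _ HA), HP.
Qed.

Variable S : Om -> nat -> Prop.
Hypothesis HS : forall k, A (fun w => S w k).

Lemma measurable_pick_of_tail j n :
  (forall k, A (fun w => tail (d w) (x0 w) (fun n => D n w) (S w) j k)) ->
  A (fun w => pick (d w) (x0 w) (fun n => D n w) (S w) j = n).
Proof.
  intros Ht. apply (measurable_least (fun w => _)). intros m.
  apply (measurable_unbounded (fun w => _)). intros k.
  apply (sigma_and _ _ HA); [apply Ht|apply measurable_near].
Qed.

(** The index picked at stage [j] varies with the parameter, so the condition is split over its
    countably many values. *)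
Lemma measurable_tail j k : A (fun w => tail (d w) (x0 w) (fun n => D n w) (S w) j k).
Proof.
  revert k. induction j as [|j IH]; intros k; [apply HS|].
  apply (sigma_and _ _ HA); [apply IH|].
  apply (sigma_ext _ _ (fun w => exists n, pick (d w) (x0 w) (fun n => D n w) (S w) j = n /\
    near (d w) (x0 w) (fun n => D n w) j n k)).
  { intros w. split; [intros (n & <- & H); exact H|]. intros H. eexists. split; [reflexivity|exact H]. }
  apply (sigma_ex _ _ HA (fun n w => _)). intros n.
  apply (sigma_and _ _ HA); [now apply measurable_pick_of_tail|apply measurable_near].
Qed.

(** A pointwise limit of functions, each chosen from a countable Borel family by a measurable
    integer. *)
Lemma borel_selection x :
  (forall w, is_metric (d w)) -> (forall w, proper_space (d w)) ->
  (forall w z e, e > 0 -> exists n, d w z (D n w) < e) ->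
  L x -> borel_fun A (fun w => selection (d w) (x0 w) (fun n => D n w) (S w) (x w)).
Proof.
  intros Hd Hprop Hdense Hx.
  apply (borel_fun_cv _ _ HA (fun j w =>
    dist_fun (d w) (x0 w) (D (pick (d w) (x0 w) (fun n => D n w) (S w) j) w) (x w))).
  - intros j. apply (borel_fun_select _ _ HA (fun n w => dist_fun (d w) (x0 w) (D n w) (x w))).
    + intros n. now apply borel_dist_fun.
    + intros n. apply measurable_pick_of_tail. intros k. apply measurable_tail.
  - intros w. apply (selection_cv _ _ _ (Hd w) (fun n => D n w) (Hdense w) (Hprop w)).
Qed.

End BorelField.

Lemma measurable_start (Om : Type) (A : (Om -> Prop) -> Prop) (X : Om -> Type)
  (d : forall w, X w -> X w -> R) (L : (forall w, X w) -> Prop)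
  (x0 : forall w, X w) (D : nat -> forall w, X w) (c k : nat) :
  sigma_algebra A -> (forall x y, L x -> L y -> borel_fun A (fun w => d w (x w) (y w))) ->
  L x0 -> (forall n, L (D n)) ->
  A (fun w => start (d w) (x0 w) (fun n => D n w) c k).
Proof.
  intros HA HL Hx0 HD. unfold start. destruct (of_nat c) as [n M].
  apply (sigma_or _ _ HA); [now apply measurable_near with L|].
  apply (sigma_not _ _ HA). apply (measurable_unbounded _ _ _ _ L); [assumption..|].
  intros m. now apply measurable_near with L.
Qed.

(** * Assembly of both claims over the whole field *)

Theorem mainTheorem10 (Om : Type) (A : (Om -> Prop) -> Prop) (X : Om -> Type)
  (d : forall w, X w -> X w -> R) (L : (forall w, X w) -> Prop) (x0 : forall w, X w) :
  sigma_algebra A ->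
  borel_field A X d L ->
  (forall w, proper_space (d w)) ->
  (forall w, CAT0 (d w)) ->
  L x0 ->
  (* (i) *)
  ((forall x, L x -> L_C0 A X d L x0 (fun w => i_map d x0 w (x w))) /\
   borel_subfield_C0 A X d L x0 (iX d x0) /\
   borel_subfield_C0 A X d L x0 (cl_iX d x0)) /\
  (* (ii) *)
  (borel_subfield_C0 A X d L x0 (bdX d x0) /\
   (forall w f, bdX d x0 w f -> cl_iX d x0 w f) /\
   (forall w f, cl_iX d x0 w f -> in_closure (d w) (x0 w) (bdX d x0 w) f ->
      bdX d x0 w f)).
Proof.
  intros HA (Hd & HL & _ & D & HD & Hdense) Hprop Hcat Hx0.
  assert (HiC0 : forall w f, iX d x0 w f -> in_C0 (d w) (x0 w) f)
    by (intros w; apply (in_C0_is_dist_fun _ _ _ (Hd w))).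
  assert (HiL : forall x, L x -> L_C0 A X d L x0 (fun w => i_map d x0 w (x w))).
  { intros x Hx. split.
    - intros w. apply (in_C0_dist_fun _ _ _ (Hd w)).
    - intros y Hy. now apply (borel_dist_fun _ _ _ _ L). }
  assert (HDC0 : forall w f, (exists n, f = i_map d x0 w (D n w)) -> in_C0 (d w) (x0 w) f).
  { intros w f [n ->]. apply (in_C0_dist_fun _ _ _ (Hd w)). }
  (* Moving a point changes its function uniformly by at most twice the distance, so the images of
     [D] serve as dense sections for both the image and its closure. *)
  assert (Hcl : forall w f, in_C0 (d w) (x0 w) f -> in_closure (d w) (x0 w) (iX d x0 w) f ->
    in_closure (d w) (x0 w) (fun g => exists n, g = i_map d x0 w (D n w)) f).
  { intros w f HC Hf. rewrite (in_closure_iff _ _ _) in Hf |- * by auto.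
    intros M e He. destruct (Hf M (e / 2)) as (g & [x Hx] & Hg); [lra|].
    destruct (dist_fun_dense _ _ (x0 w) (Hd w) (fun n => D n w) (Hdense w) x (e / 2))
      as (n & _ & Hn); [lra|].
    exists (i_map d x0 w (D n w)). split; [now exists n|].
    replace e with (e / 2 + e / 2) by field.
    apply near_on_trans with g; [exact Hg|].
    intros z Hz. rewrite Hx. now apply (Hn M). }
  assert (Hsub : forall w f, iX d x0 w f -> in_closure (d w) (x0 w) (iX d x0 w) f).
  { intros w f Hf. apply (in_closure_iff _ _ _); auto.
    intros M e He. exists f. split; [exact Hf|]. intros z _.
    rewrite Rminus_diag, Rabs_R0. lra. }
  assert (Hbd : forall w f, bdX d x0 w f <-> in_C0 (d w) (x0 w) f /\ ideal (d w) (x0 w) f).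
  { intros w f. split.
    - intros [[HC Hf] Hn]. split; [exact HC|].
      now apply (ideal_of_limit _ _ _ (Hd w) _ (Hprop w)).
    - intros [HC Hf]. split; [split|]; [exact HC| |].
      + now apply (in_closure_ideal _ _ _ (Hd w)).
      + apply (not_dist_fun_ideal _ _ _ (Hd w)); [apply Hcat|exact Hf]. }
  assert (HDi : forall w n, iX d x0 w (i_map d x0 w (D n w)))
    by (intros w n; now exists (D n w)).
  assert (Hsel : forall w S, unbounded (d w) (x0 w) (fun n => D n w) S ->
    bdX d x0 w (selection (d w) (x0 w) (fun n => D n w) S)).
  { intros w S HS. apply Hbd. split.
    - now apply (in_C0_selection _ _ _ (Hd w) _ (Hdense w)).
    - now apply (ideal_selection _ _ _ (Hd w) _ (Hdense w)). }
  (* Turns nonemptiness of the boundary into a condition on [D], hence a measurable one. *)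
  assert (Hne : forall w, (exists f, bdX d x0 w f) <->
    unbounded (d w) (x0 w) (fun n => D n w) (fun _ => True)).
  { intros w. split.
    - intros [f Hf]. apply Hbd in Hf.
      now apply (unbounded_of_ideal _ _ _ (Hd w) _ (Hdense w) f).
    - intros H. eexists. apply Hsel, H. }
  split; [split; [exact HiL|split]|split; [|split]].
  - split; [exact HiC0|split].
    + apply (sigma_ext _ _ (fun _ => True)); [|apply HA].
      intros w. split; [|tauto]. intros _. eexists. apply (HDi w 0%nat).
    + exists (fun n w => i_map d x0 w (D n w)). split; [auto|].
      intros w _. split; [auto|]. auto.
  - split; [now intros w f [HC _]|split].
    + apply (sigma_ext _ _ (fun _ => True)); [|apply HA].
      intros w. split; [|tauto]. intros _. exists (i_map d x0 w (D 0%nat w)). split; auto.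
    + exists (fun n w => i_map d x0 w (D n w)). split; [auto|].
      intros w _. split; [split; auto|]. intros f [HC Hf]. auto.
  - split; [now intros w f [[HC _] _]|split].
    + apply (sigma_ext _ _ (fun w => unbounded (d w) (x0 w) (fun n => D n w) (fun _ => True))).
      { intros w. now rewrite Hne. }
      apply (measurable_unbounded _ _ _ _ L _ _ HA HL Hx0 HD (fun _ _ => True)).
      intros _. apply HA.
    (* These sections are Borel over all parameters; where the boundary is empty they merely take
       values in the ambient space. *)
    + exists (fun c w => selection (d w) (x0 w) (fun n => D n w)
        (start (d w) (x0 w) (fun n => D n w) c)).
      split.
      * intros c. split.
        -- intros w. now apply (in_C0_selection _ _ _ (Hd w) _ (Hdense w)).
        -- intros x Hx. apply (borel_selection _ _ _ _ L); try assumption.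
           intros k. now apply measurable_start with L.
      * intros w Hw. apply Hne in Hw. split.
        -- intros c. now apply Hsel, unbounded_start.
        -- intros f Hf. apply Hbd in Hf. destruct Hf as [HC Hf].
           apply (in_closure_iff _ _ _); [exact HC| |].
           { intros g [c ->]. now apply (in_C0_selection _ _ _ (Hd w) _ (Hdense w)). }
           intros M e He.
           destruct (selection_start_dense _ _ _ (Hd w) _ (Hdense w) (Hprop w) f M e Hf He)
             as [c Hc].
           eexists. split; [now exists c|exact Hc].
  - now intros w f [Hf _].
  - intros w f [HC _] Hf. apply Hbd. split; [exact HC|].
    rewrite (in_closure_iff _ _ _) in Hf by (auto; now intros g [[HCg _] _]).
    apply ideal_closed. intros M e He. destruct (Hf M e He) as (g & Hg & Hnear).
    exists g. split; [now apply Hbd|exact Hnear].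
Qed.
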